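(* The commutator subgroup $A_{F_4}'$ of the Artin group of type $F_4$ is the group generated by $$p_k=a_1^ka_2a_1^{-(k+1)}=[a_1^k,a_2][a_1^{-1},a_2^{-1}]\quad(k\in\mathbb{Z}),$$ $$q_\ell=a_4^\ell a_3a_4^{-(\ell+1)}=[a_4^\ell,a_3][a_4^{-1},a_3^{-1}]\quad(\ell\in\mathbb{Z}),$$ with defining relations $$p_k=p_{k+1}p_{k+2}^{-1}\ (k\in\mathbb{Z}),\quad q_\ell=q_{\ell+1}q_{\ell+2}^{-1}\ (\ell\in\mathbb{Z}),$$ $$p_kq_\ell p_{k+1}q_{\ell+1}=q_\ell p_kq_{\ell+1}p_{k+1}\quad(k,\ell\in\mathbb{Z}).$$
   Context: $A_{F_4}$ is the Artin group of type $F_4$: generators $a_1,a_2,a_3,a_4$ and relations $a_ia_j=a_ja_i$ for $|i-j|\ge2$, $a_1a_2a_1=a_2a_1a_2$, $a_2a_3a_2a_3=a_3a_2a_3a_2$, $a_3a_4a_3=a_4a_3a_4$. Commutators are $[g,h]=ghg^{-1}h^{-1}$, and $G'$ denotes the commutator subgroup of $G$. ''Generated by the listed elements with the listed defining relations'' means that the listed elements lie in $A_{F_4}'$ and that the obvious map from the abstract group with that presentation to $A_{F_4}'$ is an isomorphism. *)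

(* Defs.v *)
From HB Require Import structures.
From mathcomp Require Import all_boot all_algebra.
From mathcomp Require Import generic_quotient boolp.

Set Implicit Arguments.
Unset Strict Implicit.
Unset Printing Implicit Defensive.

Import GRing.Theory.

Local Open Scope quotient_scope.
Local Open Scope group_scope.

(* Integer powers in a group; the library only has x ^+ n and x ^- n for
   n : nat. *)
Definition expgz (G : groupType) (x : G) (k : int) : G :=
  match k with Posz n => x ^+ n | Negz n => x ^- n.+1 end.

Notation "x ^z k" := (expgz x k)
  (at level 29, left associativity) : group_scope.

(* The library's [~ x, y] is x^-1 * y^-1 * x * y, hence this one. *)
Definition commutator (G : groupType) (x y : G) : G := x * y * x^-1 * y^-1.

(* The subgroup generated by the commutators, i.e. the smallest subgroup
   containing all of them. *)
Definition derived (G : groupType) : {pred G} :=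
  fun g => `[< forall S : {pred G}, group_closed S ->
                 (forall x y, commutator x y \in S) -> g \in S >].

Arguments derived : clear implicits.

Section DerivedGroup.
Variable G : groupType.

Lemma derivedP (g : G) :
  reflect (forall S : {pred G}, group_closed S ->
             (forall x y, commutator x y \in S) -> g \in S)
          (g \in derived G).
Proof. exact: asboolP. Qed.

Lemma mem_commutator (x y : G) : commutator x y \in derived G.
Proof. by apply/derivedP => S _; apply. Qed.

Lemma derived_closed : group_closed (derived G).
Proof.
split=> [|x y /derivedP xG /derivedP yG]; apply/derivedP => S Sgrp Scomm.
  by case: Sgrp.
by case: (Sgrp) => _; apply; [apply: xG|apply: yG].
Qed.

Record derived_group : Type := DerivedGroup {
  derived_val :> G;
  derived_valP : derived_val \in derived G }.

HB.instance Definition _ := [isSub for derived_val].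
HB.instance Definition _ := [Choice of derived_group by <:].
HB.instance Definition _ :=
  SubChoice_isSubGroup.Build G (derived G) derived_group derived_closed.

End DerivedGroup.

(* Group terms over the generators X: formal products and inverses. *)
Inductive term (X : Type) : Type :=
| Gen of X
| One
| Mul of term X & term X
| Inv of term X.

Arguments One {X}.

HB.instance Definition _ (X : Type) := gen_eqMixin (term X).
HB.instance Definition _ (X : Type) := gen_choiceMixin (term X).
HB.instance Definition _ (X : Type) := hasMul.Build (term X) (@Mul X).
HB.instance Definition _ (X : Type) := hasOne.Build (term X) One.
HB.instance Definition _ (X : Type) := hasInv.Build (term X) (@Inv X).

(* The smallest congruence on terms that contains the defining relations
   r (where r s t stands for the relation s = t) and the group axioms. *)
Inductive pres_eq (X : Type) (r : term X -> term X -> Prop) :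
    term X -> term X -> Prop :=
| pres_eq_rel s t of r s t : pres_eq r s t
| pres_eq_refl s : pres_eq r s s
| pres_eq_sym s t of pres_eq r s t : pres_eq r t s
| pres_eq_trans s t u of pres_eq r s t & pres_eq r t u : pres_eq r s u
| pres_eq_mul s s' t t' of pres_eq r s s' & pres_eq r t t' :
    pres_eq r (s * t) (s' * t')
| pres_eq_inv s s' of pres_eq r s s' : pres_eq r s^-1 s'^-1
| pres_eq_mulA s t u : pres_eq r (s * (t * u)) (s * t * u)
| pres_eq_mul1 s : pres_eq r (1 * s) s
| pres_eq_1mul s : pres_eq r (s * 1) s
| pres_eq_Vmul s : pres_eq r (s^-1 * s) 1
| pres_eq_mulV s : pres_eq r (s * s^-1) 1.

Section Presentation.
Variables (X : Type) (r : term X -> term X -> Prop).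

Definition pres_eqb : rel (term X) := fun s t => `[< pres_eq r s t >].

Lemma pres_eqb_equiv : equiv_class_of pres_eqb.
Proof.
split=> [s|s t|t s u].
- exact/asboolP/pres_eq_refl.
- by apply/asboolP/asboolP => /pres_eq_sym.
- by move=> /asboolP st /asboolP tu; apply/asboolP/(pres_eq_trans st tu).
Qed.

Canonical pres_eqb_equivrel := EquivRelPack pres_eqb_equiv.

(* The group < X | r >. *)
Definition pres : Type := {eq_quot pres_eqb}.

HB.instance Definition _ := Choice.on pres.
HB.instance Definition _ := Quotient.on pres.

Definition pres_class (t : term X) : pres := \pi_pres t.

Definition pres_gen (x : X) : pres := pres_class (Gen x).

Lemma pres_classP s t : pres_class s = pres_class t <-> pres_eq r s t.
Proof.
split=> [/(@eqmodP _ pres_eqb_equivrel)/asboolP //|st].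
by apply/(@eqmodP _ pres_eqb_equivrel)/asboolP.
Qed.

Lemma pres_reprP t : pres_eq r (repr (pres_class t)) t.
Proof. by apply/pres_classP; rewrite /pres_class reprK. Qed.

Definition pres_mul (x y : pres) : pres := pres_class (repr x * repr y).
Definition pres_one : pres := pres_class 1.
Definition pres_inv (x : pres) : pres := pres_class (repr x)^-1.

Lemma pres_class_ind (P : pres -> Prop) :
  (forall t, P (pres_class t)) -> forall x, P x.
Proof. by move=> PT x; have := PT (repr x); rewrite /pres_class reprK. Qed.

Lemma pres_mul_class s t :
  pres_mul (pres_class s) (pres_class t) = pres_class (s * t).
Proof. by apply/pres_classP/pres_eq_mul; apply: pres_reprP. Qed.

Lemma pres_inv_class s : pres_inv (pres_class s) = pres_class s^-1.
Proof. by apply/pres_classP/pres_eq_inv/pres_reprP. Qed.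

Lemma pres_mulA : associative pres_mul.
Proof.
elim/pres_class_ind => s; elim/pres_class_ind => t; elim/pres_class_ind => u.
by rewrite !pres_mul_class; apply/pres_classP/pres_eq_mulA.
Qed.

Lemma pres_mul1 : left_id pres_one pres_mul.
Proof.
elim/pres_class_ind => s.
by rewrite pres_mul_class; apply/pres_classP/pres_eq_mul1.
Qed.

Lemma pres_1mul : right_id pres_one pres_mul.
Proof.
elim/pres_class_ind => s.
by rewrite pres_mul_class; apply/pres_classP/pres_eq_1mul.
Qed.

Lemma pres_Vmul : left_inverse pres_one pres_inv pres_mul.
Proof.
elim/pres_class_ind => s.
by rewrite pres_inv_class pres_mul_class; apply/pres_classP/pres_eq_Vmul.
Qed.

Lemma pres_mulV : right_inverse pres_one pres_inv pres_mul.
Proof.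
elim/pres_class_ind => s.
by rewrite pres_inv_class pres_mul_class; apply/pres_classP/pres_eq_mulV.
Qed.

HB.instance Definition _ :=
  isGroup.Build pres pres_mulA pres_mul1 pres_1mul pres_Vmul pres_mulV.

Lemma pres_classM s t : pres_class (s * t) = pres_class s * pres_class t.
Proof. by rewrite -pres_mul_class. Qed.

Lemma pres_class1 : pres_class 1 = 1.
Proof. by []. Qed.

Lemma pres_classV s : pres_class s^-1 = (pres_class s)^-1.
Proof. by rewrite -pres_inv_class. Qed.

End Presentation.

Fixpoint term_eval (X : Type) (G : groupType) (f : X -> G) (t : term X) : G :=
  match t with
  | Gen x => f x
  | One => 1
  | Mul s t => term_eval f s * term_eval f t
  | Inv s => (term_eval f s)^-1
  end.

Section UniversalProperty.
Variables (X : Type) (r : term X -> term X -> Prop) (G : groupType).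

Lemma pres_class_eval t : pres_class r t = term_eval (pres_gen r) t.
Proof.
by elim: t => //= [s <- t <-|s <-]; rewrite ?(pres_classM, pres_classV).
Qed.

Lemma pres_universal (f : X -> G) :
  (forall s t, r s t -> term_eval f s = term_eval f t) ->
  exists phi : UMagmaMorphism.type (pres r) G, forall x, phi (pres_gen r x) = f x.
Proof.
move=> fr.
have ev s t : pres_eq r s t -> term_eval f s = term_eval f t.
  elim=> //= {s t} [s t u _ -> _ -> //|s s' t t' _ -> _ -> //|s s' _ -> //|||||].
  - by move=> *; rewrite mulgA.
  - by move=> *; rewrite mul1g.
  - by move=> *; rewrite mulg1.
  - by move=> *; rewrite mulVg.
  - by move=> *; rewrite mulgV.
pose phi (x : pres r) := term_eval f (repr x).
have phiM : {morph phi : x y / x * y}.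
  by move=> x y; rewrite /phi (ev _ _ (pres_reprP _ _)).
have phi1 : phi 1 = 1 := ev _ _ (pres_reprP _ _).
pose mphi := isUMagmaMorphism.Build _ _ phi (phi1, phiM).
pose psi : UMagmaMorphism.type (pres r) G := HB.pack phi mphi.
exists psi => x.
exact: (ev _ _ (pres_reprP _ _)).
Qed.

Lemma pres_morph_unique (phi psi : UMagmaMorphism.type (pres r) G) :
  (forall x, phi (pres_gen r x) = psi (pres_gen r x)) -> phi =1 psi.
Proof.
move=> eq_gen; elim/pres_class_ind; elim=> [x||s IHs t IHt|s IHs].
- exact: eq_gen.
- by rewrite pres_class1 !gmulf1.
- by rewrite pres_classM !gmulfM IHs IHt.
- by rewrite pres_classV !gmulfV IHs.
Qed.

End UniversalProperty.

Inductive F4_gen : Set := A1 | A2 | A3 | A4.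

Inductive F4_rel : term F4_gen -> term F4_gen -> Prop :=
| F4_rel13 : F4_rel (Gen A1 * Gen A3) (Gen A3 * Gen A1)
| F4_rel14 : F4_rel (Gen A1 * Gen A4) (Gen A4 * Gen A1)
| F4_rel24 : F4_rel (Gen A2 * Gen A4) (Gen A4 * Gen A2)
| F4_rel12 : F4_rel (Gen A1 * Gen A2 * Gen A1) (Gen A2 * Gen A1 * Gen A2)
| F4_rel23 : F4_rel (Gen A2 * Gen A3 * Gen A2 * Gen A3)
                    (Gen A3 * Gen A2 * Gen A3 * Gen A2)
| F4_rel34 : F4_rel (Gen A3 * Gen A4 * Gen A3) (Gen A4 * Gen A3 * Gen A4).

Definition artin_F4 : groupType := pres F4_rel.

Definition a1 : artin_F4 := pres_gen F4_rel A1.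
Definition a2 : artin_F4 := pres_gen F4_rel A2.
Definition a3 : artin_F4 := pres_gen F4_rel A3.
Definition a4 : artin_F4 := pres_gen F4_rel A4.

Definition p_ (k : int) : artin_F4 := a1 ^z k * a2 * a1 ^z (- (k + 1))%R.
Definition q_ (l : int) : artin_F4 := a4 ^z l * a3 * a4 ^z (- (l + 1))%R.

Inductive pq_gen : Set := genP of int | genQ of int.

Definition tP (k : int) : term pq_gen := Gen (genP k).
Definition tQ (l : int) : term pq_gen := Gen (genQ l).

Inductive pq_rel : term pq_gen -> term pq_gen -> Prop :=
| pq_relP (k : int) : pq_rel (tP k) (tP (k + 1)%R * (tP (k + 2)%R)^-1)
| pq_relQ (l : int) : pq_rel (tQ l) (tQ (l + 1)%R * (tQ (l + 2)%R)^-1)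
| pq_relPQ (k l : int) :
    pq_rel (tP k * tQ l * tP (k + 1)%R * tQ (l + 1)%R)
           (tQ l * tP k * tQ (l + 1)%R * tP (k + 1)%R).

Definition pq_group : groupType := pres pq_rel.

(* Main.v *)
(** The element a1 shifts the index of the p_k by conjugation and centralises
    the q_l, and a4 does the converse; moreover a1 and a4 commute.  Hence the
    presented group K carries an action of Z^2 by index shifts, and sending a1,
    a4 to the generators of Z^2, a2 = p_0 a1 and a3 = q_0 a4 identifies the
    Artin group with the semidirect product of K by Z^2: the braid relations of
    (a1, a2) and (a4, a3) become the relations among the p_k and among the q_l,
    and a2 a3 a2 a3 = a3 a2 a3 a2 becomes the mixed relation.  Commutators have
    trivial Z^2-component, so the derived subgroup is K. *)
From HB Require Import structures.
Require Import Defs.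
From mathcomp Require Import all_boot all_algebra.
From mathcomp Require Import boolp ring.

Set Implicit Arguments.
Unset Strict Implicit.
Unset Printing Implicit Defensive.

Import GRing.Theory.

Local Open Scope group_scope.

(** * Integer powers and the elements x^k y x^-(k+1) *)

Section IntegerPowers.
Variable G : groupType.
Implicit Types (x y g : G) (k l : int).

Lemma expgzS x k : x ^z (k + 1)%R = x ^z k * x.
Proof.
case: k => [n|[|n]]; first by rewrite /= addn1 expgSr.
  by rewrite /= expg1 mulVg.
have -> : (Negz n.+1 + 1)%R = Negz n by rewrite !NegzE -[in LHS]addn1; ring.
by rewrite /= [in RHS]expgS invgM mulgVK.
Qed.

Lemma expgzB1 x k : x ^z (k - 1)%R = x ^z k * x^-1.
Proof. by rewrite -{2}(subrK 1%R k) expgzS mulgK. Qed.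

Lemma expgzD x k l : x ^z (k + l)%R = x ^z k * x ^z l.
Proof.
elim: l => [|n IHn|n IHn]; first by rewrite addr0 mulg1.
  by rewrite -addn1 PoszD addrA !expgzS IHn mulgA.
by rewrite -addn1 PoszD opprD addrA !expgzB1 IHn mulgA.
Qed.

Lemma expgzN x k : x ^z (- k)%R = (x ^z k)^-1.
Proof. by apply: (mulgI (x ^z k)); rewrite -expgzD subrr mulgV. Qed.

Lemma expgz_additive (f : int -> G) :
  {morph f : k l / (k + l)%R >-> k * l} -> forall k, f k = f 1%R ^z k.
Proof.
move=> fD; have f0 : f 0%R = 1 by apply: (mulgI (f 0%R)); rewrite -fD mulg1.
elim=> // n IHn; first by rewrite -addn1 PoszD fD expgzS IHn.
by rewrite -addn1 PoszD opprD expgzB1 -IHn; apply: (mulIg (f 1%R));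
  rewrite -fD subrK mulgVK.
Qed.

Lemma commuteXz x y k : commute x y -> commute x (y ^z k).
Proof.
by case: k => n xy /=; [apply: commuteX | apply/commuteV/commuteX].
Qed.

(** Treats both generator families at once: by conversion, [p_ k] is [braid_family a1 a2 k] and
    [q_ l] is [braid_family a4 a3 l]. *)
Definition braid_family x y k := x ^z k * y * x ^z (- (k + 1))%R.

Lemma braid_family0 x y : braid_family x y 0%R = y * x^-1.
Proof. by rewrite /braid_family mul1g. Qed.

Lemma braid_family1 x y : braid_family x y 1%R = x * y * (x * x)^-1.
Proof. by []. Qed.

Lemma braid_family_shift x y k l :
  x ^z l * braid_family x y k = braid_family x y (k + l)%R * x ^z l.
Proof.
rewrite /braid_family -[RHS]mulgA -expgzD !mulgA -expgzD [(l + k)%R]addrC.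
by congr (_ * _ * _ ^z _); ring.
Qed.

Lemma commute_braid_family g x y k :
  commute g x -> commute g y -> commute g (braid_family x y k).
Proof.
by move=> gx gy; do 2?apply: commuteM => //; apply: commuteXz.
Qed.

(** The braid relation turns the second commutator into y x^-1, and [x^k, y] y = x^k y x^-k. *)
Lemma braid_family_commutator x y k : x * y * x = y * x * y ->
  braid_family x y k = commutator (x ^z k) y * commutator x^-1 y^-1.
Proof.
move=> xyx; rewrite /braid_family expgzN addrC expgzD /commutator !invgK.
have -> : x^-1 * y^-1 * x * y = y * x^-1.
  by apply: (mulgI (y * x)); rewrite !mulgA mulgK mulgV mul1g -xyx mulgK.
by rewrite invgM !mulgA mulgVK.
Qed.

(** Conjugation by x^k reduces to k = 0, where b_0 b_2 = b_1 reads y x y x^-3 = x y x^-2, which is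
    the braid relation. *)
Lemma braid_family_rel x y k : x * y * x = y * x * y ->
  braid_family x y k
    = braid_family x y (k + 1)%R * (braid_family x y (k + 2)%R)^-1.
Proof.
move=> xyx; set b := braid_family x y.
suff bk : b k * b (k + 2)%R = b (k + 1)%R by rewrite -bk mulgK.
apply: (mulIg (x ^z k)).
rewrite [(k + 2)%R]addrC [(k + 1)%R]addrC -[k in b k]add0r -mulgA.
rewrite -!braid_family_shift mulgA -braid_family_shift -mulgA; congr (_ * _).
rewrite braid_family0 braid_family1 /braid_family.
rewrite -[x ^z 2]/(x * x) -[x ^z _]/((x * (x * x))^-1).
by rewrite !mulgA mulgVK -xyx invgM !mulgA mulgK.
Qed.

End IntegerPowers.

Lemma gmulfXz (G H : groupType) (f : UMagmaMorphism.type G H) x k :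
  f (x ^z k) = f x ^z k.
Proof. by case: k => n /=; rewrite ?gmulfV gmulfXn. Qed.

Lemma gmulf_braid_family (G H : groupType) (f : UMagmaMorphism.type G H) x y k :
  f (braid_family x y k) = braid_family (f x) (f y) k.
Proof. by rewrite /braid_family !gmulfM !gmulfXz. Qed.

Lemma pres_rel_eval (X : Type) (r : term X -> term X -> Prop) s t :
  r s t -> term_eval (pres_gen r) s = term_eval (pres_gen r) t.
Proof. by move=> rst; rewrite -!pres_class_eval; apply/pres_classP/pres_eq_rel. Qed.

(** * The action of Z^2 on the presented group K by index shifts *)

Section ShiftAction.

Local Notation K := pq_group.

Definition pq_class (x : pq_gen) : K := pres_gen pq_rel x.

Definition shift_gen (v : int * int) (x : pq_gen) : pq_gen :=
  match x with
  | genP k => genP (k + v.1)%R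
  | genQ l => genQ (l + v.2)%R
  end.

(** Each family of defining relations is stable under translating the indices, so the shifted
    generators satisfy them again. *)
Lemma shift_exists v : exists phi : UMagmaMorphism.type K K,
  forall x, phi (pres_gen pq_rel x) = pq_class (shift_gen v x).
Proof.
apply: pres_universal => s t [k|l|k l] /=.
- by rewrite !(addrAC k _ v.1); apply: pres_rel_eval (pq_relP _).
- by rewrite !(addrAC l _ v.2); apply: pres_rel_eval (pq_relQ _).
- rewrite !(addrAC k _ v.1) !(addrAC l _ v.2).
  exact: pres_rel_eval (pq_relPQ _ _).
Qed.

Definition shift v : UMagmaMorphism.type K K := projT1 (cid (shift_exists v)).

Lemma shift_pq_class v x : shift v (pq_class x) = pq_class (shift_gen v x).
Proof. exact: projT2 (cid (shift_exists v)) x. Qed.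

Lemma shift0 : shift 0%R =1 id.
Proof.
apply: (@pres_morph_unique _ _ _ _ idfun) => x.
by rewrite shift_pq_class; case: x => k /=; rewrite addr0.
Qed.

Lemma shiftD v w : shift (v + w)%R =1 shift v \o shift w.
Proof.
apply: (@pres_morph_unique _ _ _ _ (shift v \o shift w)) => x /=.
by rewrite !shift_pq_class; case: x => k /=; rewrite addrAC addrA.
Qed.

End ShiftAction.

(** * The semidirect product of K by Z^2 *)

Definition shift_prod : Type := (pq_group * (int * int))%type.

HB.instance Definition _ := Choice.on shift_prod.

Section SemidirectProduct.
Implicit Types x y z : shift_prod.

Definition shift_prod_mul x y : shift_prod :=
  (x.1 * shift x.2 y.1, (x.2 + y.2)%R).
Definition shift_prod_one : shift_prod := (1, 0%R).
Definition shift_prod_inv x : shift_prod := (shift (- x.2)%R x.1^-1, (- x.2)%R).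

Lemma shift_prod_mulA : associative shift_prod_mul.
Proof.
move=> x y z; congr pair => /=; last exact: addrA.
by rewrite gmulfM shiftD mulgA.
Qed.

Lemma shift_prod_mul1 : left_id shift_prod_one shift_prod_mul.
Proof. by case=> x v; rewrite /shift_prod_mul /= shift0 mul1g add0r. Qed.

Lemma shift_prod_1mul : right_id shift_prod_one shift_prod_mul.
Proof. by case=> x v; rewrite /shift_prod_mul /= gmulf1 mulg1 addr0. Qed.

Lemma shift_prod_Vmul : left_inverse shift_prod_one shift_prod_inv shift_prod_mul.
Proof.
by case=> x v; rewrite /shift_prod_mul /= -gmulfM mulVg gmulf1 addNr.
Qed.

Lemma shift_prod_mulV : right_inverse shift_prod_one shift_prod_inv shift_prod_mul.
Proof.
case=> x v; rewrite /shift_prod_mul /= -[shift v _]/((shift v \o _) _).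
by rewrite -shiftD subrr shift0 mulgV.
Qed.

End SemidirectProduct.

HB.instance Definition _ := isGroup.Build shift_prod
  shift_prod_mulA shift_prod_mul1 shift_prod_1mul shift_prod_Vmul shift_prod_mulV.

Definition base (x : pq_group) : shift_prod := (x, 0%R).
Definition trans (v : int * int) : shift_prod := (1, v).

Lemma shift_prodM (x y : shift_prod) :
  x * y = (x.1 * shift x.2 y.1, (x.2 + y.2)%R).
Proof. by []. Qed.

Lemma shift_prodV (x : shift_prod) : x^-1 = (shift (- x.2)%R x.1^-1, (- x.2)%R).
Proof. by []. Qed.

Lemma trans_base v x : trans v * base x = base (shift v x) * trans v.
Proof. by rewrite !shift_prodM /= gmulf1 mul1g mulg1 addr0 add0r. Qed.

Lemma baseM : {morph base : x y / x * y}.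
Proof. by move=> x y; rewrite shift_prodM /= shift0 addr0. Qed.

Lemma baseV : {morph base : x / x^-1}.
Proof. by move=> x; rewrite shift_prodV /= oppr0 shift0. Qed.

Lemma transD v w : trans (v + w)%R = trans v * trans w.
Proof. by rewrite shift_prodM /= gmulf1 mulg1. Qed.

Lemma trans_expgz1 k : trans (1%R, 0%R) ^z k = trans (k, 0%R).
Proof.
rewrite -(expgz_additive (f := fun k => trans (k, 0%R))) // => m n.
by rewrite -transD.
Qed.

Lemma trans_expgz2 l : trans (0%R, 1%R) ^z l = trans (0%R, l).
Proof.
rewrite -(expgz_additive (f := fun l => trans (0%R, l))) // => m n.
by rewrite -transD.
Qed.

(** * The homomorphism from the Artin group to the semidirect product *)

Definition artin_gen (x : F4_gen) : shift_prod :=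
  match x with
  | A1 => trans (1%R, 0%R)
  | A2 => base (pq_class (genP 0%R)) * trans (1%R, 0%R)
  | A3 => base (pq_class (genQ 0%R)) * trans (0%R, 1%R)
  | A4 => trans (0%R, 1%R)
  end.

(** The relation freed of inverses, which is the shape a braid relation takes in the component K. *)
Lemma pq_relP_class k :
  pq_class (genP k) * pq_class (genP (k + 2)%R) = pq_class (genP (k + 1)%R).
Proof.
by rewrite [pq_class (genP k)](pres_rel_eval (pq_relP k)) /= mulgVK.
Qed.

Lemma pq_relQ_class l :
  pq_class (genQ l) * pq_class (genQ (l + 2)%R) = pq_class (genQ (l + 1)%R).
Proof.
by rewrite [pq_class (genQ l)](pres_rel_eval (pq_relQ l)) /= mulgVK.
Qed.

Lemma artin_exists : exists phi : UMagmaMorphism.type artin_F4 shift_prod,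
  forall x, phi (pres_gen F4_rel x) = artin_gen x.
Proof.
apply: pres_universal => s t [] /=; rewrite !shift_prodM /=;
  congr pair => //;
  rewrite ?gmulf1 ?mulg1 ?mul1g ?shift_pq_class /= ?(add0r, addr0) //.
(* The commutation relations are gone, since (1,0) fixes every q_l and (0,1) every p_k. The others
   leave p_1 = p_0 p_2, then p_0 q_0 p_1 q_1 = q_0 p_0 q_1 p_1, then q_0 q_2 = q_1. *)
- exact: esym (pq_relP_class 0).
- exact: pres_rel_eval (pq_relPQ 0 0).
- exact: pq_relQ_class 0.
Qed.

Definition artin_split : UMagmaMorphism.type artin_F4 shift_prod :=
  projT1 (cid artin_exists).

Lemma artin_splitE x : artin_split (pres_gen F4_rel x) = artin_gen x.
Proof. exact: projT2 (cid artin_exists) x. Qed.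

Lemma artin_split_p k : artin_split (p_ k) = base (pq_class (genP k)).
Proof.
rewrite -[p_ k]/(braid_family a1 a2 k) gmulf_braid_family !artin_splitE.
(* Multiplying by the k-th power of the translation allows the shift identity to bring the index
   down to 0, where the image of a2 a1^-1 is known. *)
apply: (mulIg (trans (1%R, 0%R) ^z k)); rewrite -[k in braid_family _ _ k]add0r.
rewrite -braid_family_shift braid_family0 mulgK trans_expgz1 trans_base.
by rewrite shift_pq_class /= add0r.
Qed.

Lemma artin_split_q l : artin_split (q_ l) = base (pq_class (genQ l)).
Proof.
rewrite -[q_ l]/(braid_family a4 a3 l) gmulf_braid_family !artin_splitE.
apply: (mulIg (trans (0%R, 1%R) ^z l)); rewrite -[l in braid_family _ _ l]add0r.
rewrite -braid_family_shift braid_family0 mulgK trans_expgz2 trans_base.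
by rewrite shift_pq_class /= add0r.
Qed.

(** * Commutators in the Artin group and the derived subgroup *)

Lemma braid_a1_a2 : a1 * a2 * a1 = a2 * a1 * a2.
Proof. exact: pres_rel_eval F4_rel12. Qed.

Lemma braid_a4_a3 : a4 * a3 * a4 = a3 * a4 * a3.
Proof. exact: esym (pres_rel_eval F4_rel34). Qed.

Lemma pE k : p_ k = commutator (a1 ^z k) a2 * commutator a1^-1 a2^-1.
Proof. exact: braid_family_commutator braid_a1_a2. Qed.

Lemma qE l : q_ l = commutator (a4 ^z l) a3 * commutator a4^-1 a3^-1.
Proof. exact: braid_family_commutator braid_a4_a3. Qed.

Lemma p_derived k : p_ k \in derived artin_F4.
Proof.
by rewrite pE; apply: (group_closedM (derived_closed artin_F4));
  apply: mem_commutator.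
Qed.

Lemma q_derived l : q_ l \in derived artin_F4.
Proof.
by rewrite qE; apply: (group_closedM (derived_closed artin_F4));
  apply: mem_commutator.
Qed.

(** As Z^2 is abelian, the elements with trivial Z^2-component form a subgroup containing all
    commutators; minimality of the derived subgroup applies. *)
Lemma derived_split2 g : g \in derived artin_F4 -> (artin_split g).2 = 0%R.
Proof.
move=> /derivedP/(_ (fun g => (artin_split g).2 == 0%R)) H.
apply/eqP/H => [|x y]; last first.
  rewrite unfold_in /commutator !gmulfM !gmulfV !shift_prodM /=.
  by rewrite addrAC addrK subrr.
split=> [|x y]; rewrite !unfold_in ?gmulf1 //.
by rewrite gmulfM gmulfV /= => /eqP-> /eqP->; rewrite subr0.
Qed.

Lemma a1_a4 : commute a1 a4.
Proof. exact: pres_rel_eval F4_rel14. Qed.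

Lemma a1_a3 : commute a1 a3.
Proof. exact: pres_rel_eval F4_rel13. Qed.

Lemma a2_a4 : commute a2 a4.
Proof. exact: pres_rel_eval F4_rel24. Qed.

(** * Lifting Z^2 to the Artin group, and the mixed relation *)

Definition trans_elt (v : int * int) : artin_F4 := a1 ^z v.1 * a4 ^z v.2.

Lemma trans_eltD v w : trans_elt (v + w)%R = trans_elt v * trans_elt w.
Proof.
rewrite /trans_elt /= !expgzD -!mulgA; congr (_ * _).
rewrite !mulgA; congr (_ * _).
exact/commuteXz/commute_sym/commuteXz/commute_sym/a1_a4.
Qed.

Lemma trans_elt0 : trans_elt 0%R = 1.
Proof. by rewrite /trans_elt /= mulg1. Qed.

(** a4 commutes with a1 and a2, hence with every p_k, so only the power of a1 acts, and it shifts
    the index. *)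
Lemma trans_p v k : trans_elt v * p_ k = p_ (k + v.1)%R * trans_elt v.
Proof.
have a4p : commute (a4 ^z v.2) (p_ k).
  apply/commute_sym/commuteXz/commute_sym/commute_braid_family.
    exact/commute_sym/a1_a4.
  exact/commute_sym/a2_a4.
have a1p : a1 ^z v.1 * p_ k = p_ (k + v.1)%R * a1 ^z v.1.
  exact: braid_family_shift.
by rewrite /trans_elt -[LHS]mulgA a4p [LHS]mulgA a1p -[LHS]mulgA.
Qed.

Lemma trans_q v l : trans_elt v * q_ l = q_ (l + v.2)%R * trans_elt v.
Proof.
have a1q : commute (q_ (l + v.2)%R) (a1 ^z v.1).
  apply/commuteXz/commute_sym/commute_braid_family; first exact: a1_a4.
  exact: a1_a3.
have a4q : a4 ^z v.2 * q_ l = q_ (l + v.2)%R * a4 ^z v.2.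
  exact: braid_family_shift.
by rewrite /trans_elt -[LHS]mulgA a4q [LHS]mulgA -a1q -[LHS]mulgA.
Qed.

(** Substitute a2 = p_0 a1 and a3 = q_0 a4 in the relation of length four and move all translations
    to the right: both sides end in [trans_elt] of (2,2), which cancels. *)
Lemma pq_rel0 :
  p_ 0 * q_ 0 * p_ 1 * q_ 1 = q_ 0 * p_ 0 * q_ 1 * p_ 1.
Proof.
have a2E : a2 = p_ 0 * trans_elt (1%R, 0%R).
  by rewrite [p_ 0]braid_family0 /trans_elt /= mulg1 mulgVK.
have a3E : a3 = q_ 0 * trans_elt (0%R, 1%R).
  by rewrite [q_ 0]braid_family0 /trans_elt /= mul1g mulgVK.
have tp x v k : x * trans_elt v * p_ k = x * p_ (k + v.1)%R * trans_elt v.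
  by rewrite -[LHS]mulgA trans_p [LHS]mulgA.
have tq x v l : x * trans_elt v * q_ l = x * q_ (l + v.2)%R * trans_elt v.
  by rewrite -[LHS]mulgA trans_q [LHS]mulgA.
have tt' x v w : x * trans_elt v * trans_elt w = x * trans_elt (v + w)%R.
  by rewrite -mulgA -trans_eltD.
have := pres_rel_eval F4_rel23; rewrite /= -/a2 -/a3 a2E a3E.
(* Generalised so that mulgA does not unfold the products they stand for. *)
move: p_ q_ trans_elt tp tq tt' {a2E a3E} => p q t tp tq tt'.
by rewrite !mulgA !(tp, tq, tt') => /mulIg.
Qed.

(** Conjugating the case of indices 0 by a1^k a4^l shifts all p-indices by k and all q-indices by
    l. *)
Lemma pq_rel_artin k l :
  p_ k * q_ l * p_ (k + 1)%R * q_ (l + 1)%R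
    = q_ l * p_ k * q_ (l + 1)%R * p_ (k + 1)%R.
Proof.
set t := trans_elt (k, l).
have pt m : p_ (m + k)%R = p_ m ^ t^-1.
  by rewrite conjgE invgK mulgA trans_p mulgK.
have qt m : q_ (m + l)%R = q_ m ^ t^-1.
  by rewrite conjgE invgK mulgA trans_q mulgK.
rewrite -[k in p_ k]add0r -[l in q_ l]add0r [(k + 1)%R]addrC [(l + 1)%R]addrC.
by rewrite !pt !qt -!conjMg pq_rel0.
Qed.

(** * The isomorphism from K onto the derived subgroup *)

Lemma pq_to_derived_exists :
  exists phi : UMagmaMorphism.type pq_group (derived_group artin_F4),
    forall x, phi (pres_gen pq_rel x) = match x with
      | genP k => DerivedGroup (p_derived k)
      | genQ l => DerivedGroup (q_derived l)
      end.
Proof.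
apply: pres_universal => s t [k|l|k l]; apply: val_inj => /=.
- exact: braid_family_rel braid_a1_a2.
- exact: braid_family_rel braid_a4_a3.
- exact: pq_rel_artin.
Qed.

Theorem theorem3p15 :
  (forall k : int, p_ k = commutator (a1 ^z k) a2 * commutator a1^-1 a2^-1) /\
  (forall l : int, q_ l = commutator (a4 ^z l) a3 * commutator a4^-1 a3^-1) /\
  (forall k : int, p_ k \in derived artin_F4) /\
  (forall l : int, q_ l \in derived artin_F4) /\
  exists phi : UMagmaMorphism.type pq_group (derived_group artin_F4),
    (forall k : int, derived_val (phi (pres_gen pq_rel (genP k))) = p_ k) /\
    (forall l : int, derived_val (phi (pres_gen pq_rel (genQ l))) = q_ l) /\
    bijective phi.
Proof.
split; [exact: pE|split; [exact: qE|]].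
split; [exact: p_derived|split; [exact: q_derived|]].
have [phi phiE] := pq_to_derived_exists.
exists phi; split=> [k|]; first by rewrite phiE.
split=> [l|]; first by rewrite phiE.
(* On K the composite with [artin_split] is the embedding [base]; this makes [phi] injective. *)
have phiK x : artin_split (derived_val (phi x)) = base x.
  elim/pres_class_ind: x; elim=> [[k|l]||s IHs t IHt|s IHs].
  - by rewrite phiE artin_split_p.
  - by rewrite phiE artin_split_q.
  - by rewrite pres_class1 !gmulf1.
  - by rewrite pres_classM !gmulfM IHs IHt baseM.
  - by rewrite pres_classV !gmulfV IHs baseV.
(* The shift rules for p_k and q_l extend from generators to all of K; this is what makes [Psi]
   below multiplicative. *)
have trans_phi v x :
    trans_elt v * derived_val (phi x)
      = derived_val (phi (shift v x)) * trans_elt v.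
  elim/pres_class_ind: x; elim=> [[k|l]||s IHs t IHt|s IHs].
  - by rewrite (shift_pq_class v (genP k)) !phiE trans_p.
  - by rewrite (shift_pq_class v (genQ l)) !phiE trans_q.
  - by rewrite pres_class1 !gmulf1 mulg1 mul1g.
  - by rewrite pres_classM !gmulfM mulgA IHs -mulgA IHt mulgA.
  - rewrite pres_classV !gmulfV.
    apply: (mulgI (derived_val (phi (shift v (pres_class pq_rel s))))).
    by rewrite mulgA -IHs mulgK mulVKg.
(* The map back from the semidirect product, a left inverse of [artin_split] by the check on
   generators in [PsiK]. *)
pose Psi (x : shift_prod) : artin_F4 := derived_val (phi x.1) * trans_elt x.2.
have PsiM x y : Psi (x * y) = Psi x * Psi y.
  rewrite /Psi /= gmulfM trans_eltD -[LHS]mulgA -[RHS]mulgA; congr (_ * _).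
  by rewrite [LHS]mulgA -trans_phi -[LHS]mulgA.
have Psi1 : Psi 1 = 1 by rewrite /Psi gmulf1 mul1g trans_elt0.
have PsiK g : Psi (artin_split g) = g.
  elim/pres_class_ind: g; elim=> [x||s IHs t IHt|s IHs].
  - rewrite artin_splitE; case: x => /=; rewrite ?PsiM /Psi /= ?gmulf1.
    + by rewrite mul1g /trans_elt mulg1.
    + rewrite phiE /= [p_ 0]braid_family0 trans_elt0 mulg1 mul1g.
      by rewrite /trans_elt mulg1 mulgVK.
    + rewrite phiE /= [q_ 0]braid_family0 trans_elt0 mulg1 mul1g.
      by rewrite /trans_elt mul1g mulgVK.
    + by rewrite mul1g /trans_elt mul1g.
  - by rewrite pres_class1 gmulf1.
  - by rewrite pres_classM gmulfM PsiM IHs IHt.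
  (* [Psi] is not packaged as a morphism, so the inverse is handled by cancellation, using only
     multiplicativity and [Psi1]. *)
  - rewrite pres_classV; apply: (mulgI (pres_class F4_rel s)).
    by rewrite -{1}IHs -PsiM -gmulfM !mulgV gmulf1.
exists (fun x => (artin_split (derived_val x)).1) => [x|x]; first by rewrite phiK.
(* For surjectivity, g equals [Psi] of its image; on the derived subgroup the Z^2-component is 0, so
   only the [phi] factor remains. *)
apply: val_inj; rewrite /= -[RHS]PsiK /Psi derived_split2 ?trans_elt0 ?mulg1 //.
exact: derived_valP.
Qed.
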